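(* Let $\phi_1,\dots,\phi_N:X\to\mathbb R$ be continuous and assume that $$\mu\left(\{x\in X:\ \phi_i(x)-\phi_j(x)=r\}\right)=0\quad\text{for all } i\neq j \text{ in } I \text{ and all } r\in\mathbb R .$$ Then for every $\vec m\in S_I:=\{\vec m\in\mathbb R^N:\ m_i\ge0\ \text{for all } i\in I,\ \sum_{i\in I}m_i=1\}$ there is a unique optimal partition, i.e. a unique $\vec\mu\in\mathcal P^{w}_{\vec m}$ maximizing $\sum_{i=1}^N\int_X\phi_i\,d\mu_i$ over $\mathcal P^{w}_{\vec m}$, and this unique partition is a strong one.
   Context: $X$ is a compact Polish space with Borel $\sigma$-algebra $\mathcal B$, $\mu$ is a non-atomic Borel probability measure on $X$, and $I=\{1,\dots,N\}$. This is the Monge case, in which all price functions satisfy $\psi_1=\dots=\psi_N\equiv1$. For $\vec m\in\mathbb R^N$, $\mathcal P^{w}_{\vec m}$ (weak partitions) is the set of $N$-tuples $\vec\mu=(\mu_1,\dots,\mu_N)$ of non-negative Borel measures on $X$ with $\sum_i\mu_i=\mu$ and $\mu_i(X)=m_i$ for all $i\in I$. Such a $\vec\mu$ is called strong if there are sets $X_1,\dots,X_N\in\mathcal B$ with $\bigcup_iX_i=X$, $\mu(X_i\cap X_j)=0$ for $i\ne j$, $\mu(X_i)=m_i$, and $\mu_i=\mu\lfloor X_i$ (restriction of $\mu$ to $X_i$) for all $i$. *)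

(* Defs.v *)
From mathcomp Require Import all_boot all_order all_algebra.
From mathcomp Require Import all_classical all_reals all_analysis.

Set Implicit Arguments.
Unset Strict Implicit.
Unset Printing Implicit Defensive.

Import Order.TTheory GRing.Theory Num.Theory.
Import numFieldNormedType.Exports.

Local Open Scope classical_set_scope.
Local Open Scope ring_scope.

Definition separable (T : topologicalType) :=
  exists2 S : set T, countable S & dense S.

Definition homeomorphic (S T : topologicalType) :=
  exists (f : S -> T) (g : T -> S),
    [/\ cancel f g, cancel g f, continuous f & continuous g].

(* The library has no structure joining [metricType] and [completeType], so the
   filter condition defining [completeType] is written out; its [cvg F] becomes
   an explicit limit because a [metricType] need not be pointed. *)
Definition completely_metrizable (R : realType) (T : topologicalType) :=
  exists M : metricType R,
    (forall F : set_system M, ProperFilter F -> cauchy F ->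
       exists x : M, F --> x) /\
    homeomorphic T M.

Definition polish (R : realType) (T : topologicalType) :=
  separable T /\ completely_metrizable R T.

(* Measurable types are pointed in the library, so [X] has to be a
   [ptopologicalType]; a space carrying a probability measure is nonempty
   anyway. *)
Notation borelType X := (g_sigma_algebraType (@open X)).

Definition nonatomic d (T : measurableType d) (R : realType)
    (mu : {measure set T -> \bar R}) :=
  forall A : set T, measurable A -> (0 < mu A)%E ->
    exists B : set T, [/\ measurable B, B `<=` A & (0 < mu B < mu A)%E].

Definition simplex (R : realType) (N : nat) (m : 'I_N -> R) :=
  (forall i, 0 <= m i) /\ \sum_(i < N) m i = 1.

Section partitions.
Context d (T : measurableType d) (R : realType) (N : nat).
Variable mu : {measure set T -> \bar R}.
Implicit Types (m : 'I_N -> R) (nu : 'I_N -> {measure set T -> \bar R}).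

(* A measure of the library assigns a value to every set but is constrained
   only on measurable ones, so equality of measures is always tested on
   measurable sets. *)
Definition same_measures nu nu' :=
  forall i (A : set T), measurable A -> nu i A = nu' i A.

Definition weak_partition m nu :=
  (forall A : set T, measurable A -> (\sum_(i < N) nu i A)%E = mu A) /\
  (forall i, nu i [set: T] = (m i)%:E).

Definition strong_partition m nu :=
  exists (X_ : 'I_N -> set T) (mX : forall i, measurable (X_ i)),
    [/\ \bigcup_i X_ i = [set: T],
        forall i j, i != j -> mu (X_ i `&` X_ j) = 0%E,
        forall i, mu (X_ i) = (m i)%:E
      & forall i (A : set T), measurable A -> nu i A = mrestr mu (mX i) A].

Definition total_profit (phi : 'I_N -> T -> R) nu : \bar R :=
  (\sum_(i < N) \int[nu i]_x (phi i x)%:E)%E.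

Definition optimal_partition (phi : 'I_N -> T -> R) m nu :=
  weak_partition m nu /\
  forall nu', weak_partition m nu' ->
    (total_profit phi nu' <= total_profit phi nu)%E.

End partitions.

(* Main.v *)
Require Import Defs.
From mathcomp Require Import all_boot all_order all_algebra.
From mathcomp Require Import all_classical all_reals all_analysis.
From mathcomp Require Import measurable_realfun lra.

Set Implicit Arguments.
Unset Strict Implicit.
Unset Printing Implicit Defensive.

Import Order.TTheory GRing.Theory Num.Theory.
Import numFieldNormedType.Exports.

Local Open Scope classical_set_scope.
Local Open Scope ring_scope.

(** Think of the points [x] as auctioned among [N] players, player [i] offering
[phi i x] plus a subsidy [p i]. The cells [cell phi p i], where player [i] makes
the best offer, cover the space and overlap only in level sets of the
differences [phi i - phi j], hence in null sets. Two facts give the theorem.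

- Some [p] makes the cells have the prescribed masses. It is found as a
minimizer of the dual function, the integral of the best offer minus
[\sum_i p i * m i]. Raising [p i] by [t] increases the best offer by at most
[t], and only on the new cell of [i], so at a minimizer the new cell has mass at
least [m i]; as [t] tends to 0 the same holds for the cell of [p] itself
([min_cell]). Since the masses of the cells and the numbers [m i] both add up
to 1, all these inequalities are equalities ([min_cell_mass]). A minimizer
exists because [p] can be clamped into a fixed cube without increasing the dual
function ([dual_clamp]), which is Lipschitz in [p].

- For every weak partition the profit is the dual value minus the sum of the
integrals of the nonnegative gaps between the best offer and the offer of [i],
against the [i]-th measure ([total_profit_gap]). Restricting [mu] to the cells
makes these gaps vanish, hence is optimal. Conversely, in an optimal partition
the [i]-th measure must be carried by the [i]-th cell; as the cells overlap in
null sets, that determines it ([concentrated_eq_cell]).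

Compactness and continuity are used to make the functions [phi i] bounded and
Borel measurable. *)

(** * Covers with null overlaps *)

Section measure_facts.
Context d (T : measurableType d) (R : realType).
Implicit Type mu : {measure set T -> \bar R}.

Lemma measureU_null mu (A B : set T) : measurable A -> measurable B ->
  mu (A `&` B) = 0%E -> mu (A `|` B) = (mu A + mu B)%E.
Proof.
move=> mA mB AB0.
have -> : A `|` B = A `|` (B `\` A) by rewrite setDE setUIr setUv setIT.
rewrite measureU//; [|exact: measurableD|by rewrite setIC -setIA setICl setI0].
rewrite (measureDI mu mB mA); congr (_ + _)%E.
rewrite [X in (_ + X)%E](_ : _ = 0%E) ?adde0// (setIC B A). exact: AB0.
Qed.

Lemma measurable_bigsetU_seq (I : Type) (s : seq I) (F : I -> set T) :
  (forall i, measurable (F i)) -> measurable (\big[setU/set0]_(i <- s) F i).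
Proof. by move=> mF; elim/big_ind : _ => // *; exact: measurableU. Qed.

Lemma measure_bigsetU_null mu (I : eqType) (s : seq I) (F : I -> set T) :
  (forall i, measurable (F i)) ->
  (forall i j, i != j -> mu (F i `&` F j) = 0%E) -> uniq s ->
  mu (\big[setU/set0]_(i <- s) F i) = (\sum_(i <- s) mu (F i))%E.
Proof.
move=> mF F0; elim: s => [|i s IH]; first by rewrite !big_nil measure0.
move=> /= /andP[si us]; rewrite !big_cons measureU_null ?IH//.
  exact: measurable_bigsetU_seq.
move: si; rewrite big_distrr/= => si.
(* a finite union of null sets [F i `&` F j] is null *)
elim: s {us IH} si => [|j s IH]; first by rewrite big_nil measure0.
rewrite inE negb_or big_cons => /andP[ij si].
have mI k : measurable (F i `&` F k) by exact: measurableI.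
by rewrite measureU0 ?F0// ?IH//; exact: measurable_bigsetU_seq.
Qed.

(** A cover with null overlaps is as good as a partition for computing
    measures. *)
Lemma measure_null_cover mu (I : finType) (F : I -> set T) (A : set T) :
  (forall i, measurable (F i)) ->
  (forall i j, i != j -> mu (F i `&` F j) = 0%E) ->
  (forall x, exists i, F i x) -> measurable A ->
  (\sum_i mu (A `&` F i))%E = mu A.
Proof.
move=> mF F0 cF mA.
rewrite -(measure_bigsetU_null (F := fun i => A `&` F i)) ?index_enum_uniq//.
- rewrite -big_distrr/=; congr (mu _); apply/setIidPl => x _.
  have [i Fix] := cF x; rewrite -bigcup_seq.
  by exists i => //=; rewrite mem_index_enum.
- by move=> i; exact: measurableI.
- move=> i j ij; apply: subset_measure0 (F0 _ _ ij).
  + by do !apply: measurableI.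
  + exact: measurableI.
  + by move=> x [[_ ?] [_ ?]].
Qed.

Lemma bounded_integrable mu (f : T -> R) (C : R) : (mu setT < +oo)%E ->
  measurable_fun setT f -> (forall x, `|f x| <= C) ->
  mu.-integrable setT (EFin \o f).
Proof.
move=> fmu mf fC; apply: measurable_bounded_integrable => //.
exists C; split; first exact: num_real.
by move=> M CM x _; exact: le_trans (fC x) (ltW CM).
Qed.

End measure_facts.

(** * Best offers and cells *)

Section envelope.
Context d (T : measurableType d) (R : realType) (n : nat).
Context (phi : 'I_n.+1 -> T -> R) (C : R).
Context (phi_meas : forall i, measurable_fun setT (phi i)).
Context (phi_bound : forall i x, `|phi i x| <= C).
Implicit Types (p q : 'I_n.+1 -> R) (x : T).

(** The reals having no least element, the iterated maximum starts from one of
    the offers. *)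
Definition best p x : R :=
  \big[Num.max/phi ord0 x + p ord0]_i (phi i x + p i).

Definition cell p i : set T :=
  [set x | forall j, phi j x + p j <= phi i x + p i].

Lemma bestP p x : exists2 i, cell p i x & best p x = phi i x + p i.
Proof.
have [i _ imax] :=
  @arg_maxP _ R 'I_n.+1 ord0 predT (fun i => phi i x + p i) isT.
have ci : cell p i x by move=> j; exact: imax.
exists i => //; apply/eqP; rewrite eq_le le_bigmax andbT.
by apply/bigmax_leP; split => [|j _]; exact: ci.
Qed.

Lemma le_best p i x : phi i x + p i <= best p x.
Proof. exact: le_bigmax. Qed.

Lemma best_le p x b : (forall i, phi i x + p i <= b) -> best p x <= b.
Proof. by move=> h; have [i _ ->] := bestP p x. Qed.

Lemma best_cell p i x : cell p i x -> best p x = phi i x + p i.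
Proof. by move=> h; apply/eqP; rewrite eq_le le_best best_le. Qed.

Lemma measurable_offer p i : measurable_fun setT (fun x => phi i x + p i).
Proof. exact: measurable_funD. Qed.

Lemma measurable_best p : measurable_fun setT (best p).
Proof.
rewrite /best; elim: (index_enum _) => [|i s IH].
  by under eq_fun do rewrite big_nil; exact: measurable_offer.
under eq_fun do rewrite big_cons.
by apply: measurable_maxr => //; exact: measurable_offer.
Qed.

Lemma measurable_cell p i : measurable (cell p i).
Proof.
have -> : cell p i =
    \bigcap_(j in [set: 'I_n.+1]) [set x | phi j x + p j <= phi i x + p i].
  by apply/seteqP; split => x /= h j; [move=> _|]; exact: h.
apply: fin_bigcap_measurable => // j _; rewrite -[X in measurable X]setTI.
by apply: measurable_fun_le => //; exact: measurable_offer.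
Qed.

Lemma bounded_best p : exists K, forall x, `|best p x| <= K.
Proof.
exists (C + \sum_i `|p i|) => x; have [i _ ->] := bestP p x.
rewrite (le_trans (ler_normD _ _))// lerD//.
by rewrite (bigD1 i)//= lerDl sumr_ge0.
Qed.

Lemma cellI p i j : cell p i `&` cell p j `<=`
  [set x | phi i x - phi j x = p j - p i].
Proof.
move=> x [/best_cell hi /best_cell]/=; rewrite hi => hj.
by apply/eqP; rewrite subr_eq addrAC eq_sym subr_eq addrC -hj addrC. 
Qed.

Lemma cellI_null (mu : {measure set T -> \bar R}) p i j :
  (forall r, mu [set x | phi i x - phi j x = r] = 0%E) ->
  mu (cell p i `&` cell p j) = 0%E.
Proof.
move=> null; apply: subset_measure0 (null (p j - p i)); last exact: cellI.
  by apply: measurableI; exact: measurable_cell.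
rewrite -[X in measurable X]setTI.
have mf : measurable_fun setT (fun x => phi i x - phi j x).
  exact: measurable_funB.
exact: (mf measurableT [set p j - p i]).
Qed.

End envelope.

(** * Minimizing the dual function *)

Section dual_problem.
Context d (T : measurableType d) (R : realType) (n : nat).
Context (mu : probability T R) (phi : 'I_n.+1 -> T -> R) (C : R).
Context (phi_meas : forall i, measurable_fun setT (phi i)).
Context (phi_bound : forall i x, `|phi i x| <= C).
Context (m : 'I_n.+1 -> R) (m_simplex : simplex m).
Implicit Types (p q : 'I_n.+1 -> R) (x : T).

Let m_ge0 i : 0 <= m i. Proof. by case: m_simplex. Qed.
Let m_sum1 : \sum_i m i = 1. Proof. by case: m_simplex. Qed.

Definition dual p : R := \int[mu]_x best phi p x - \sum_i p i * m i.

Definition raise p i t : 'I_n.+1 -> R := fun j => p j + t *+ (j == i).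

Lemma integrable_best p : mu.-integrable setT (EFin \o best phi p).
Proof.
have [K bK] := bounded_best phi_bound p.
apply: bounded_integrable bK; last exact: measurable_best.
by rewrite -ge0_fin_numE// fin_num_measure.
Qed.

Lemma integrable_cst_prob (r : R) : mu.-integrable setT (EFin \o cst r).
Proof. exact: finite_measure_integrable_cst. Qed.

Lemma Rintegral_add_cst (f : T -> R) r : mu.-integrable setT (EFin \o f) ->
  \int[mu]_x (f x + r) = \int[mu]_x f x + r.
Proof.
move=> fi; rewrite RintegralD//; last exact: integrable_cst_prob.
rewrite Rintegral_cst//= (_ : fine _ = 1) ?mulr1//.
by rewrite [X in fine X]probability_setT.
Qed.

Lemma Rintegral_best_le p q r : (forall x, best phi q x <= best phi p x + r) ->
  \int[mu]_x best phi q x <= \int[mu]_x best phi p x + r.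
Proof.
move=> qp; rewrite -Rintegral_add_cst; last exact: integrable_best.
apply: le_Rintegral => //; first exact: integrable_best.
rewrite (_ : EFin \o _ = (EFin \o best phi p) \+ (EFin \o cst r)).
  apply: integrableD => //; first exact: integrable_best.
  exact: integrable_cst_prob.
by apply/funext.
Qed.

(** Where player [i] does not win after the raise, the winner's offer was
    already available before it. *)
Lemma best_raise_le p i t x : 0 <= t ->
  best phi (raise p i t) x <=
  best phi p x + t * \1_(cell phi (raise p i t) i) x.
Proof.
move=> t0; have [j cj ->] := bestP phi (raise p i t) x.
rewrite indicE; have [|xi] := boolP (x \in cell phi (raise p i t) i).
  rewrite inE => ci.
  apply: (@le_trans _ _ (phi i x + raise p i t i)); first exact: ci.
  by rewrite /raise eqxx mulr1 mulr1n addrA lerD2r le_best.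
have ji : j != i.
  by apply: contraNneq xi => ji; rewrite inE -[X in cell _ _ X]ji.
by rewrite /raise (negbTE ji) !mulr0n mulr0 !addr0 le_best.
Qed.

(** A one-sided estimate suffices, so the dual function need not be
    differentiated; it bounds the increment by the mass of the cell after the
    raise, not before it. *)
Lemma dual_raise p i t : 0 <= t ->
  dual (raise p i t) - dual p
    <= t * (fine (mu (cell phi (raise p i t) i)) - m i).
Proof.
move=> t0; rewrite /dual.
set c := cell phi _ i.
have mc : measurable c by exact: measurable_cell.
have ic : mu.-integrable setT (EFin \o (fun x => t * \1_c x)).
  apply: (@bounded_integrable _ _ _ _ _ t).
  - by rewrite -ge0_fin_numE// fin_num_measure.
  - by apply: measurable_funM => //; exact: measurable_indic.
  - move=> x; rewrite indicE; case: (_ \in _); rewrite ?mulr1 ?mulr0 ?normr0//.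
    by rewrite ger0_norm.
have I1 : \int[mu]_x best phi (raise p i t) x <=
          \int[mu]_x best phi p x + t * fine (mu c).
  apply: (@le_trans _ _ (\int[mu]_x (best phi p x + t * \1_c x))).
    apply: le_Rintegral => //; first exact: integrable_best.
      rewrite (_ : EFin \o _ =
          (EFin \o best phi p) \+ (EFin \o (fun x => t * \1_c x))).
        by apply: integrableD => //; exact: integrable_best.
      by apply/funext => x /=.
    by move=> x _; exact: best_raise_le.
  rewrite RintegralD//; last exact: integrable_best.
  rewrite lerD2l RintegralZl//.
    by rewrite /Rintegral integral_indic// setIT.
  apply: (@bounded_integrable _ _ _ _ _ 1).
  - by rewrite -ge0_fin_numE// fin_num_measure.
  - exact: measurable_indic.
  - by move=> x; rewrite indicE; case: (_ \in _); rewrite ?normr1 ?normr0.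
have -> : \sum_j raise p i t j * m j = \sum_j p j * m j + t * m i.
  under eq_bigr do rewrite /raise mulrDl.
  rewrite big_split/=; congr (_ + _).
  rewrite (bigD1 i)//= eqxx big1 ?addr0// => j /negbTE ->.
  by rewrite mulr0n mul0r.
lra.
Qed.

Lemma dual_lipschitz p q r : (forall i, `|p i - q i| <= r) ->
  dual q <= dual p + 2 * r.
Proof.
move=> pq.
have I1 : \int[mu]_x best phi q x <= \int[mu]_x best phi p x + r.
  apply: Rintegral_best_le => x; apply: best_le => i.
  have := le_best phi p i x; have := pq i; rewrite ler_norml => /andP[]; lra.
have : \sum_i p i * m i <= \sum_i q i * m i + r.
  rewrite -[X in _ + X]mulr1 -m_sum1 mulr_sumr -big_split/=.
  apply: ler_sum => i _; rewrite -mulrDl ler_wpM2r//.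
  by have := pq i; rewrite ler_norml => /andP[]; lra.
rewrite /dual; lra.
Qed.

(** Adding a constant to all subsidies changes nothing, so the largest one may
    be taken to be [2 * C]. A player whose subsidy is then negative can have it
    increased to 0 without exceeding the offer of the player with subsidy
    [2 * C] anywhere; so the best offer stays, and only the subtracted sum
    grows. *)
Lemma dual_clamp p : exists2 q,
  (forall i, 0 <= q i <= 2 * C) & dual q <= dual p.
Proof.
have C0 : 0 <= C by rewrite (le_trans _ (phi_bound ord0 point))//.
have [k _ kmax] := @arg_maxP _ R 'I_n.+1 ord0 predT p isT.
pose s := 2 * C - p k.
pose q i := Num.max (p i + s) 0.
exists q => [i|].
  rewrite /q le_max lexx orbT/= ge_max.
  have pik : p i <= p k := kmax i isT.
  by apply/andP; split; rewrite /s; lra.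
have I1 : \int[mu]_x best phi q x <= \int[mu]_x best phi p x + s.
  apply: Rintegral_best_le => x; apply: best_le => i.
  rewrite /q addr_maxr addr0 ge_max.
  apply/andP; split.
    by have := le_best phi p i x; lra.
  (* a clamped offer is at most [C], which is at most the shifted offer of [k] *)
  have := phi_bound i x; have := phi_bound k x; have := le_best phi p k x.
  by rewrite !ler_norml /s => ? /andP[? ?] /andP[? ?]; lra.
have : \sum_i p i * m i + s <= \sum_i q i * m i.
  rewrite -[X in _ + X]mulr1 -m_sum1 mulr_sumr -big_split/=.
  apply: ler_sum => i _; rewrite -mulrDl ler_wpM2r//.
  by rewrite /q le_max lexx.
rewrite /dual; lra.
Qed.

Lemma dual_min : exists p, forall q, dual p <= dual q.
Proof.
pose f (v : 'rV[R]_n.+1) := dual (v ord0).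
pose box := [set v : 'rV[R]_n.+1 | forall i, `[0, 2 * C]%classic (v ord0 i)].
have C0 : 0 <= C by rewrite (le_trans _ (phi_bound ord0 point))//.
have boxc : compact box.
  apply: (@rV_compact R n.+1 (fun=> `[0, 2 * C]%classic)) => i.
  exact: segment_compact.
have fc : continuous f.
  move=> v; apply/(@cvgrPdist_le _ _ _ (nbhs v) _ f (f v)) => e e0.
  have e2 : 0 < e / 2 by rewrite divr_gt0.
  near=> w.
  have [_ vw] : ball v (e / 2) w by near: w; exact: nbhsx_ballx.
  have {}vw i : `|v ord0 i - w ord0 i| <= e / 2 by exact: ltW (vw ord0 i).
  have wv i : `|w ord0 i - v ord0 i| <= e / 2 by rewrite distrC.
  have := dual_lipschitz vw; have := dual_lipschitz wv.
  by rewrite ler_norml /f; lra.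
have [||v _ vmin] := @EVT_min_rV R n.+1 f box _ boxc.
- by exists 0 => i /=; rewrite mxE in_itv/= lexx mulr_ge0.
- exact: continuous_subspaceT.
exists (v ord0) => q; have [q' q'b] := dual_clamp q; apply: le_trans.
have -> : q' = (\row_i q' i) ord0 by apply/funext => i; rewrite mxE.
by apply: vmin; rewrite inE => i /=; rewrite mxE in_itv/=.
Unshelve. all: by end_near. Qed.

(** [dual_raise] gives the bound for the cell of [i] after every positive raise;
    these cells shrink to that of [p] as the raise tends to 0. *)
Lemma min_cell p i : (forall q, dual p <= dual q) ->
  ((m i)%:E <= mu (cell phi p i))%E.
Proof.
move=> pmin.
pose F k := cell phi (raise p i k.+1%:R^-1) i.
have Fge k : ((m i)%:E <= mu (F k))%E.
  have k0 : 0 < k.+1%:R^-1 :> R by rewrite invr_gt0.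
  have := dual_raise p i (ltW k0); have := pmin (raise p i k.+1%:R^-1).
  rewrite -subr_ge0 => /le_trans/[apply]; rewrite pmulr_rge0// subr_ge0.
  by rewrite -lee_fin fineK// fin_num_measure//; exact: measurable_cell.
have FE : \bigcap_k F k = cell phi p i.
  apply/seteqP; split => x h => [j|k _ l].
    have [->//|ji] := eqVneq j i.
    suff slack (e : R) : 0 < e -> phi j x + p j <= phi i x + p i + e.
      exact/ler_addgt0Pr.
    move=> e0.
    have [k _ ke] := near_infty_natSinv_lt (PosNum e0).
    have {}ke : k.+1%:R^-1 < e := ke k (leqnn k).
    have := h k I j; rewrite /raise eqxx (negbTE ji) mulr0n mulr1n => jk.
    rewrite addr0 addrA in jk; apply: le_trans jk _.
    by rewrite lerD2l ltW.
  have : 0 < k.+1%:R^-1 :> R by rewrite invr_gt0.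
  rewrite /raise eqxx; case: (l =P i) => [->//|_].
  by move: (h l); move: (k.+1%:R^-1) => t; rewrite mulr0n mulr1n; lra.
have mF k : measurable (F k) by exact: measurable_cell.
have Fcvg : mu (F k) @[k --> \oo] --> mu (cell phi p i).
  rewrite -FE; apply: nonincreasing_cvg_mu => //.
  - by rewrite -ge0_fin_numE// fin_num_measure.
  - exact: bigcapT_measurable.
  - move=> a b ab; apply/subsetPset => x h l; have := h l.
    have : (b.+1%:R^-1 <= a.+1%:R^-1 :> R).
      by rewrite lef_pV2 ?posrE// ler_nat.
    rewrite /raise eqxx; case: (l =P i) => [->//|_].
    by move: (b.+1%:R^-1) (a.+1%:R^-1) => s t; rewrite !mulr0n !mulr1n; lra.
by apply: (cvge_ge _ Fcvg); apply: nearW.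
Qed.

End dual_problem.

(** * Integrals against weak partitions *)

Section weak_partitions.
Context d (T : measurableType d) (R : realType) (n : nat).
Context (mu : {measure set T -> \bar R}) (m : 'I_n.+1 -> R).
Context (nu : 'I_n.+1 -> {measure set T -> \bar R}).
Context (nu_weak : weak_partition mu m nu).

Lemma weak_partition_fin i : (nu i setT < +oo)%E.
Proof. by rewrite nu_weak.2 ltry. Qed.

Lemma weak_partition_setT : mu setT = (\sum_i m i)%:E.
Proof.
rewrite -nu_weak.1// -sumEFin; apply: eq_bigr => i _; exact: nu_weak.2.
Qed.

Lemma weak_partition_null i (A : set T) : measurable A ->
  mu A = 0%E -> nu i A = 0%E.
Proof.
move=> mA A0; apply/eqP; rewrite -measure_le0 -A0 -nu_weak.1//.
by rewrite (bigD1 i)//= leeDl// sume_ge0.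
Qed.

Lemma weak_partition_ge0_integral (f : T -> \bar R) :
  measurable_fun setT f -> (forall x, (0 <= f x)%E) ->
  (\int[mu]_x f x = \sum_i \int[nu i]_x f x)%E.
Proof.
move=> mf f0.
(* [msum] takes a family indexed by [nat] *)
pose nus k := nu (inord k).
rewrite (eq_measure_integral (msum nus n.+1)).
  rewrite ge0_integral_measure_sum//; apply: eq_bigr => i _.
  by rewrite /nus inord_val.
move=> A mA _; rewrite -[LHS]nu_weak.1// /msum/=.
by apply: eq_bigr => i _; rewrite /nus inord_val.
Qed.

Lemma weak_partition_Rintegral (f : T -> R) (K : R) :
  measurable_fun setT f -> (forall x, `|f x| <= K) ->
  \sum_i \int[nu i]_x f x = \int[mu]_x f x.
Proof.
move=> mf fK.
have fmu : (mu setT < +oo)%E by rewrite weak_partition_setT ltry.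
have fK0 x : 0 <= f x + K.
  by have := fK x; rewrite ler_norml => /andP[]; lra.
(* adding [K] reduces the claim to nonnegative functions *)
have shift (la : {measure set T -> \bar R}) : (la setT < +oo)%E ->
    \int[la]_x (f x + K) = \int[la]_x f x + K * fine (la setT).
  move=> fla; rewrite RintegralD//; first by rewrite Rintegral_cst.
    exact: bounded_integrable fK.
  exact: (@bounded_integrable _ _ _ _ _ `|K|).
have fin (la : {measure set T -> \bar R}) : (la setT < +oo)%E ->
    (\int[la]_x (f x + K)%:E \is a fin_num)%E.
  move=> fla; apply: integrable_fin_num => //.
  apply: (@bounded_integrable _ _ _ _ _ (K + K)) => //.
    exact: measurable_funD.
  by move=> x; rewrite ger0_norm// lerD2r (le_trans (ler_norm _)).
have : \sum_i \int[nu i]_x (f x + K) = \int[mu]_x (f x + K).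
  rewrite /Rintegral weak_partition_ge0_integral.
  - by apply: sum_fine => i _; apply: fin; exact: weak_partition_fin.
  - by apply/measurable_EFinP; exact: measurable_funD.
  - by move=> x; rewrite lee_fin.
rewrite shift// weak_partition_setT/=.
under eq_bigr do rewrite shift ?weak_partition_fin// nu_weak.2.
rewrite big_split/= -mulr_sumr; exact: addIr.
Qed.

End weak_partitions.

(** * Duality *)

Section strong_duality.
Context d (T : measurableType d) (R : realType) (n : nat).
Context (mu : probability T R) (phi : 'I_n.+1 -> T -> R) (C : R).
Context (phi_meas : forall i, measurable_fun setT (phi i)).
Context (phi_bound : forall i x, `|phi i x| <= C).
Context (m : 'I_n.+1 -> R).
Implicit Types (p : 'I_n.+1 -> R) (x : T).
Implicit Type nu : 'I_n.+1 -> {measure set T -> \bar R}.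

Definition gap p i x : R := best phi p x - (phi i x + p i).

Lemma gap_ge0 p i x : 0 <= gap p i x.
Proof. by rewrite subr_ge0 le_best. Qed.

Lemma measurable_gap p i : measurable_fun setT (gap p i).
Proof.
by apply: measurable_funB; [exact: measurable_best|exact: measurable_offer].
Qed.

Lemma gap_eq0 p i x : gap p i x = 0 <-> cell phi p i x.
Proof.
split=> [/eqP|/best_cell h]; last by rewrite /gap h subrr.
by rewrite subr_eq0 => /eqP h j; rewrite -h le_best.
Qed.

Lemma bounded_gap p i : exists K, forall x, `|gap p i x| <= K.
Proof.
have [K bK] := bounded_best phi_bound p.
exists (K + (C + `|p i|)) => x; rewrite (le_trans (ler_normB _ _))// lerD//.
by rewrite (le_trans (ler_normD _ _))// lerD.
Qed.

(** The complementary slackness condition: the gap is positive exactly off the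
    cell. *)
Lemma Rintegral_gap_eq0 (la : {measure set T -> \bar R}) p i :
  (la setT < +oo)%E ->
  \int[la]_x gap p i x = 0 <-> la (~` cell phi p i) = 0%E.
Proof.
move=> fla; have mc := measurable_cell phi_meas p i.
have mg : measurable_fun setT (EFin \o gap p i).
  by apply/measurable_EFinP; exact: measurable_gap.
have [K bK] := bounded_gap p i.
have gi : la.-integrable setT (EFin \o gap p i).
  by apply: bounded_integrable bK => //; exact: measurable_gap.
have absE : (\int[la]_x `|(EFin \o gap p i) x| =
             (\int[la]_x gap p i x)%:E)%E.
  rewrite /Rintegral fineK; last exact: integrable_fin_num.
  by apply: eq_integral => x _ /=; rewrite ger0_norm ?gap_ge0.
have [ae0 ae1] := ae_eq_integral_abs la measurableT mg; split=> [g0|c0].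
  have [|N [mN N0 sN]] := ae0; first by rewrite absE g0.
  apply: subset_measure0 N0 => //; first exact: measurableC.
  apply: subset_trans sN => x /= ncx gx; apply: ncx; apply/gap_eq0.
  by have [] := gx I.
apply: EFin_inj; rewrite -absE; apply: ae1; exists (~` cell phi p i).
split=> //; first exact: measurableC.
by move=> x /= + cx; apply => _; congr EFin; exact/gap_eq0.
Qed.

(** The best offer has the same total integral for all weak partitions, and the
    subsidies cost [\sum_i p i * m i] whatever the partition; only the gaps
    depend on it. *)
Lemma total_profit_gap p nu : weak_partition mu m nu ->
  total_profit phi nu =
  (dual mu phi m p - \sum_i \int[nu i]_x gap p i x)%:E.
Proof.
move=> nuw; have fnu := weak_partition_fin nuw.
have phii i : (nu i).-integrable setT (EFin \o phi i).
  exact: bounded_integrable (phi_bound i).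
have [K bK] := bounded_best phi_bound p.
have besti i : (nu i).-integrable setT (EFin \o best phi p).
  by apply: bounded_integrable bK => //; exact: measurable_best.
have csti i : (nu i).-integrable setT (EFin \o cst (p i)).
  exact: (@bounded_integrable _ _ _ _ _ `|p i|).
have gapE i : \int[nu i]_x gap p i x =
    \int[nu i]_x best phi p x - \int[nu i]_x phi i x - p i * m i.
  rewrite RintegralB//.
    by rewrite RintegralD// Rintegral_cst// nuw.2/= opprD addrA.
  rewrite (_ : EFin \o _ = (EFin \o phi i) \+ (EFin \o cst (p i))).
    exact: integrableD.
  by apply/funext.
under [in RHS]eq_bigr do rewrite gapE.
rewrite !sumrB (weak_partition_Rintegral nuw _ bK); last exact: measurable_best.
rewrite /dual opprB opprB [X in X%:E](_ : _ = \sum_i \int[nu i]_x phi i x).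
  rewrite -sumEFin; apply: eq_bigr => i _.
  by rewrite fineK//; exact: integrable_fin_num.
lra.
Qed.

Context (phi_null : forall i j, i != j -> forall r,
  mu [set x | phi i x - phi j x = r] = 0%E).

Lemma cells_null p i j : i != j -> mu (cell phi p i `&` cell phi p j) = 0%E.
Proof. by move=> ij; apply: cellI_null => // r; exact: phi_null. Qed.

(** Inside the cell of [i] the other measures only see the overlaps with their
    own cells, which are null; so there [nu i] is all of [mu]. *)
Lemma concentrated_eq_cell p nu i (A : set T) : weak_partition mu m nu ->
  (forall j, nu j (~` cell phi p j) = 0%E) -> measurable A ->
  nu i A = mu (A `&` cell phi p i).
Proof.
move=> nuw nu0 mA; have mc j := measurable_cell phi_meas p j.
have nuI j B : measurable B -> nu j B = nu j (B `&` cell phi p j).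
  move=> mB; rewrite [LHS](measureDI (nu j) mB (mc j)).
  rewrite [X in (X + _)%E](_ : _ = 0%E) ?add0e//.
  apply: subset_measure0 (nu0 j); [exact: measurableD|exact: measurableC|].
  by move=> x [].
rewrite nuI// -nuw.1; last exact: measurableI.
rewrite (bigD1 i)//= big1 ?adde0// => j ji.
rewrite nuI; last exact: measurableI.
apply: (weak_partition_null nuw); first by do !apply: measurableI.
apply: subset_measure0 (cells_null p ji); try by do !apply: measurableI.
by move=> x [[_ ?] ?].
Qed.

Context (m_simplex : simplex m).

(** By [min_cell] no cell is too small; the total mass 1 leaves no room for one
    to be too large. *)
Lemma min_cell_mass p i : (forall q, dual mu phi m p <= dual mu phi m q) ->
  mu (cell phi p i) = (m i)%:E.
Proof.
move=> pmin; have mc j := measurable_cell phi_meas p j.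
have fc j : mu (cell phi p j) \is a fin_num by exact: fin_num_measure.
have le j : m j <= fine (mu (cell phi p j)).
  by rewrite -lee_fin fineK//; exact: (min_cell phi_meas phi_bound j pmin).
have sum1 : \sum_j fine (mu (cell phi p j)) = 1.
  rewrite sum_fine//.
  have -> : (\sum_j mu (cell phi p j) = 1)%E.
    rewrite -(probability_setT mu) -(measure_null_cover mc (cells_null p))//.
      by apply: eq_bigr => j _; rewrite setTI.
    by move=> x; have [j cj _] := bestP phi p x; exists j.
  by [].
have : \sum_j (fine (mu (cell phi p j)) - m j) == 0.
  by rewrite sumrB sum1 m_simplex.2 subrr.
rewrite psumr_eq0; last by move=> j _; rewrite subr_ge0.
move=> /allP/(_ i (mem_index_enum _))/=; rewrite subr_eq0 => /eqP <-.
by rewrite fineK.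
Qed.

(** The restrictions of [mu] to the cells of a dual minimizer close every gap,
    so they reach the dual value, and any other optimal partition has to close
    every gap as well. *)
Theorem unique_strong_optimal_partition :
  exists nu, [/\ optimal_partition mu phi m nu,
    forall nu', optimal_partition mu phi m nu' -> same_measures nu' nu
  & strong_partition mu m nu].
Proof.
have [p pmin] := dual_min mu phi_meas phi_bound m_simplex.
have mc i := measurable_cell phi_meas p i.
have cover x : exists i, cell phi p i x.
  by have [i ci _] := bestP phi p x; exists i.
pose nu i : {measure set T -> \bar R} := mrestr mu (mc i).
have nuw : weak_partition mu m nu.
  split=> [A mA|i].
    exact: measure_null_cover mc (cells_null p) cover mA.
  by rewrite /nu/= /mrestr setTI min_cell_mass.
have nu_profit : total_profit phi nu = (dual mu phi m p)%:E.
  rewrite (total_profit_gap p nuw) big1 ?subr0// => i _.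
  apply/Rintegral_gap_eq0; first exact: weak_partition_fin nuw i.
  by rewrite /nu/= /mrestr setICl measure0.
exists nu; split.
- split=> // nu' nuw'; rewrite nu_profit (total_profit_gap p nuw') lee_fin.
  rewrite gerBl sumr_ge0// => i _.
  by apply: Rintegral_ge0 => x _; exact: gap_ge0.
- move=> nu' [nuw' opt] i A mA.
  apply: (concentrated_eq_cell i nuw') => // j.
  apply/Rintegral_gap_eq0; first exact: weak_partition_fin nuw' j.
  have gap0 k : 0 <= \int[nu' k]_x gap p k x.
    by apply: Rintegral_ge0 => x _; exact: gap_ge0.
  have := opt nu nuw; rewrite nu_profit (total_profit_gap p nuw') lee_fin.
  rewrite lerBrDr gerDl => le0.
  apply/eqP; rewrite eq_le gap0 andbT (le_trans _ le0)//.
  by rewrite (bigD1 j)//= lerDl sumr_ge0.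
- exists (cell phi p), mc; split=> //.
  + by apply/seteqP; split=> // x _; have [i ci] := cover x; exists i.
  + by move=> i j; exact: cells_null.
  + by move=> i; exact: min_cell_mass.
Qed.

End strong_duality.

(** * Continuous profits on a compact space *)

Lemma continuous_borel_measurable (X : ptopologicalType) (R : realType)
    (f : X -> R) : continuous f ->
  measurable_fun [set: borelType X] (f : borelType X -> R).
Proof.
move=> /continuousP cf.
apply: (measurability _ (RGenOpens.measurableE R)) => _ [_ [a [b ->] <-]].
rewrite setTI; apply: sub_sigma_algebra.
exact/cf/interval_open.
Qed.

Lemma compact_continuous_bounded (X : ptopologicalType) (R : realType)
    (f : X -> R) : compact [set: X] -> continuous f ->
  exists C, forall x, `|f x| <= C.
Proof.
move=> cX cf.
have [||c _ cmax] := @compact_EVT_max X R (Num.norm \o f) setT _ cX.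
- by exists point.
- apply: continuous_subspaceT => x.
  exact: continuous_comp (cf x) (@norm_continuous _ _ _).
by exists `|f c| => x; apply: cmax; rewrite inE.
Qed.

Theorem theorem4p3 (R : realType) (X : ptopologicalType)
    (compactX : compact [set: X]) (polishX : polish R X)
    (mu : probability (borelType X) R) (mu_nonatomic : nonatomic mu)
    (N : nat) (phi : 'I_N -> X -> R)
    (phi_cont : forall i, continuous (phi i))
    (phi_level : forall i j : 'I_N, i != j -> forall r : R,
       mu [set x | phi i x - phi j x = r] = 0%E)
    (m : 'I_N -> R) (m_simplex : simplex m) :
  exists nu : 'I_N -> {measure set (borelType X) -> \bar R},
    [/\ optimal_partition mu phi m nu,
        forall nu', optimal_partition mu phi m nu' -> same_measures nu' nu
      & strong_partition mu m nu].
Proof.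
case: N phi phi_cont phi_level m m_simplex => [|n] phi phi_cont phi_level m ms.
  by have := ms.2; rewrite big_ord0 => /eqP; rewrite eq_sym oner_eq0.
have /choice[b bP] i := compact_continuous_bounded compactX (phi_cont i).
apply: (@unique_strong_optimal_partition _ (borelType X) R n mu phi
  (\sum_i `|b i|)) => //.
- by move=> i; exact: continuous_borel_measurable.
- move=> i x; rewrite (le_trans (bP i x))// (le_trans (ler_norm _))//.
  by rewrite (bigD1 i)//= lerDl sumr_ge0.
Qed.
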